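(* Let $\mathcal{N}=\{X_n(k)\mid k\in[0,k_{max}]\}$ be a closed natural motion trajectory and let $\mathcal{O}_i(s_i,S_i)$, $i=1,\dots,l$, be ellipsoidal exclusion zones. Suppose that (A1) the closed-loop dynamics are $X(k+1)=\bar{A}X(k)-BKX_n(k+\delta)$ and the error dynamics are $e(k+1)=\bar{A}e(k)$, where $e(k)=X(k)-X_n(k+\delta)$ and $\bar A=A+BK$; (A2) $P=P^T>0$ is chosen such that $\bar{A}^TP\bar{A}-P=-Q$ with $Q=Q^T>0$; and that $u_{max}>0$ and $\mathcal{N}\cap\mathcal{O}_i(s_i,S_i)=\emptyset$ for $i=1,2,\dots,l$. Then there exist $\rho_k>0$ for all $k\in[0,k_{max}]$, obtained using Procedure 1 (set $\rho_k=\min_{j\in[0,k_{max}]}\rho_j^s$ for all $k\in[0,k_{max}]$, where $\rho_j^s$ are the safe scale factors), such that the tube $$\mathcal{T}_{\mathcal{N}}=\bigcup_{k\in[0,k_{max}]}\mathcal{E}_{k,\mathcal{N}},\qquad \mathcal{E}_{k,\mathcal{N}}=\{X\in\mathbb{R}^6\mid (X-X_n(k))^TP(X-X_n(k))\le\rho_k\},$$ is safe and positively-invariant.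
   Context: Dynamics: $X=[x\ y\ z\ \dot x\ \dot y\ \dot z]^T\in\mathbb{R}^6$, $X(k+1)=AX(k)+Bu(k)$, $k\in\mathbb{Z}_{\ge0}$, $u(k)\in\mathbb{R}^3$, with $\Delta T>0$, $m>0$, $\omega>0$ and $A=\exp(A_c\Delta T)$, $B=\int_0^{\Delta T}\exp(A_c(\Delta T-s))\,ds\begin{bmatrix}0_{3\times3}\\ \frac1m I_{3\times3}\end{bmatrix}$, $$A_c=\begin{bmatrix}0&0&0&1&0&0\\0&0&0&0&1&0\\0&0&0&0&0&1\\3\omega^2&0&0&0&2\omega&0\\0&0&0&-2\omega&0&0\\0&0&-\omega^2&0&0&0\end{bmatrix}$$ (Clohessy-Wiltshire equations). $\Delta T$ is chosen so that $\tau/\Delta T\in\mathbb{Z}_{>0}$, where $\tau=2\pi/\omega$, and $k_{max}=\tau/\Delta T-1$. Closed natural motion trajectory (NMT): for an initial condition $\bar X_0$ whose components satisfy $\dot y(0)=-2\omega x(0)$, $\mathcal{N}=\{X_n(k)\mid X_n(0)=\bar X_0,\ X_n(k+1)=AX_n(k),\ k\in[0,k_{max}]\}$. The sequence is periodic, $X_n(k_{max}+1)=X_n(0)$. Here $[0,k_{max}]$ denotes integers, and any index $k$ (of $X_n(k)$, $\rho_k$, $\mathcal{E}_{k,\mathcal{N}}$) outside $[0,k_{max}]$ is taken to be the equivalent index in $[0,k_{max}]$ modulo $k_{max}+1$. Control: $u(k)=K(X(k)-X_n(k+\delta))$, where $\delta\in\mathbb{Z}$ is a shift and $K$ is a gain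 matrix for which $\bar A=A+BK$ is Schur (all eigenvalues in the open unit disk). Constraints: the control constraint is $\|u(k)\|_\infty\le u_{max}$. The exclusion zones are $\mathcal{O}_i(s_i,S_i)=\{X\in\mathbb{R}^6\mid(\Phi X-s_i)^TS_i(\Phi X-s_i)\le1\}$, $s_i\in\mathbb{R}^3$, $S_i=S_i^T>0$, $\Phi=[I_{3\times3}\ 0_{3\times3}]$; the exclusion zone constraints are $1-(\Phi X-s_i)^TS_i(\Phi X-s_i)\le0$, $i=1,\dots,l$. Safe scale factors: $\rho_k^s=\min\{\rho_u,\ \rho_{Oi,k},\ i=1,\dots,l\}$. Here $\rho_u$ is the largest $\rho\ge0$ such that $\|K(X-X_n(k))\|_\infty\le u_{max}$ for all $X$ with $(X-X_n(k))^TP(X-X_n(k))\le\rho$ (it does not depend on $k$). And $\rho_{Oi,k}$ is the minimum of $\rho$ over pairs $(\rho,X)$ with $(X-X_n(k))^TP(X-X_n(k))\le\rho$ and $(\Phi X-s_i)^TS_i(\Phi X-s_i)\le1$ (so it is $0$ if $X_n(k)\in\mathcal{O}_i(s_i,S_i)$). Safe tube: $\mathcal{T}_{\mathcal{N}}$ is safe if for every $X\in\mathcal{T}_{\mathcal{N}}$ (viewed as the state $X=X(k)$ at a time $k$) all exclusion zone constraints hold at $X$ and there exists $\delta\in\mathbb{Z}$ such that the control constraint $\|K(X-X_n(k+\delta))\|_\infty\le u_{max}$ holds. Positive invariance: $\mathcal{T}_{\mathcal{N}}$ is positively-invariant with respect to the closed-loop dynamics if there exists $\delta\in\mathbb{Z}$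 such that, for every $k_1\in\mathbb{Z}_{\ge0}$ and every sequence $(X(k))_{k\ge k_1}$ satisfying $X(k+1)=\bar AX(k)-BKX_n(k+\delta)$ for $k\ge k_1$, $X(k_1)\in\mathcal{E}_{k_1+\delta,\mathcal{N}}$ implies $X(k_2)\in\mathcal{E}_{k_2+\delta,\mathcal{N}}$ for all integers $k_2\ge k_1$. *)

(* Defs.v *)
From HB Require Import structures.
From mathcomp Require Import all_boot all_order all_algebra.
From mathcomp Require Import all_classical all_reals all_analysis.
From mathcomp Require Import complex.

Set Implicit Arguments.
Unset Strict Implicit.
Unset Printing Implicit Defensive.

Import Order.TTheory GRing.Theory Num.Theory.
Import numFieldNormedType.Exports.

Local Open Scope classical_set_scope.
Local Open Scope ring_scope.

Definition quad (R : realType) (n : nat) (M : 'M[R]_n) (v : 'cV[R]_n) : R :=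
  (v^T *m M *m v) 0 0.

Definition sym_posdef (R : realType) (n : nat) (M : 'M[R]_n) : Prop :=
  M^T = M /\ forall v : 'cV[R]_n, v != 0 -> 0 < quad M v.

(* [eigenvalue] looks for roots in the base field, so the real matrix is first
   embedded into the complex matrices; the order on [R[i]] only compares numbers
   with the same imaginary part, here the real numbers [`|z|] and [1]. *)
Definition schur (R : realType) (n : nat) (M : 'M[R]_n) : Prop :=
  forall z : R[i], eigenvalue (map_mx (real_complex R) M) z -> `|z| < 1.

(* The limit of the partial sums is taken in the normed space of matrices. *)
Definition expmx (R : realType) (n : nat) (M : 'M[R]_n) : 'M[R]_n :=
  limn (series (fun j : nat => j`!%:R^-1 *: (M ^+ j : 'M[R]_n))).

(* The state is (x, y, z, x', y', z'), numbered from 0. *)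
Definition cw_Ac (R : realType) (omega : R) : 'M[R]_6 :=
  \matrix_(i < 6, j < 6) nth 0 (nth [::]
    [:: [:: 0; 0; 0; 1; 0; 0];
        [:: 0; 0; 0; 0; 1; 0];
        [:: 0; 0; 0; 0; 0; 1];
        [:: 3 * omega ^+ 2; 0; 0; 0; 2 * omega; 0];
        [:: 0; 0; 0; - (2 * omega); 0; 0];
        [:: 0; 0; - omega ^+ 2; 0; 0; 0]] i) j.

Definition cw_A (R : realType) (omega dT : R) : 'M[R]_6 :=
  expmx (dT *: cw_Ac omega).

(* The integral of the matrix-valued function is taken entrywise. *)
Definition cw_B (R : realType) (omega m dT : R) : 'M[R]_(6, 3) :=
  (\matrix_(i < 6, j < 6)
     \int[@lebesgue_measure R]_(t in `[0, dT])
       expmx ((dT - t) *: cw_Ac omega) i j)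
  *m (col_mx 0 ((1 / m)%:M) : 'M[R]_(3 + 3, 3)).

(* Reduction of an integer index modulo [kmax + 1]. *)
Definition cyc (kmax : nat) (k : int) : 'I_kmax.+1 :=
  inord `|(k %% kmax.+1%:Z)%Z|%N.

Definition nmt_init (R : realType) (omega : R) (X0 : 'cV[R]_6) : Prop :=
  X0 (inord 4) 0 = - 2 * omega * X0 (inord 0) 0.

Definition nmt_seq (R : realType) (A : 'M[R]_6) (X0 : 'cV[R]_6) (kmax : nat)
    (k : 'I_kmax.+1) : 'cV[R]_6 :=
  iter k (mulmx A) X0.

Definition Phi (R : realType) : 'M[R]_(3, 6) :=
  (row_mx 1%:M 0 : 'M[R]_(3, 3 + 3)).

Definition excl_zone (R : realType) (s : 'cV[R]_3) (S : 'M[R]_3)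
    : set 'cV[R]_6 :=
  [set X | quad S (Phi R *m X - s) <= 1].

Definition excl_constraint (R : realType) (s : 'cV[R]_3) (S : 'M[R]_3)
    (X : 'cV[R]_6) : Prop :=
  1 - quad S (Phi R *m X - s) <= 0.

(* The norm of MathComp-Analysis on matrices is the entrywise maximum norm. *)
Definition ctrl_constraint (R : realType) (K : 'M[R]_(3, 6)) (umax : R)
    (X Xref : 'cV[R]_6) : Prop :=
  `|K *m (X - Xref)| <= umax.

Definition is_max (R : realType) (D : set R) (r : R) : Prop := D r /\ ubound D r.
Definition is_min (R : realType) (D : set R) (r : R) : Prop := D r /\ lbound D r.

Definition is_rho_u (R : realType) (K : 'M[R]_(3, 6)) (umax : R) (P : 'M[R]_6)
    (Xref : 'cV[R]_6) (r : R) : Prop :=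
  is_max [set rho | 0 <= rho /\
    forall X : 'cV[R]_6, quad P (X - Xref) <= rho ->
      ctrl_constraint K umax X Xref] r.

Definition is_rho_O (R : realType) (s : 'cV[R]_3) (S : 'M[R]_3) (P : 'M[R]_6)
    (Xref : 'cV[R]_6) (r : R) : Prop :=
  is_min [set rho | exists X : 'cV[R]_6,
    quad P (X - Xref) <= rho /\ excl_zone s S X] r.

Definition is_safe_scale (R : realType) (K : 'M[R]_(3, 6)) (umax : R)
    (P : 'M[R]_6) (l : nat) (s : 'I_l -> 'cV[R]_3) (S : 'I_l -> 'M[R]_3)
    (Xref : 'cV[R]_6) (r : R) : Prop :=
  exists (rho_u : R) (rho_O : 'I_l -> R),
    [/\ is_rho_u K umax P Xref rho_u,
        forall i : 'I_l, is_rho_O (s i) (S i) P Xref (rho_O i) &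
        r = \big[Num.min/rho_u]_(i < l) rho_O i].

Definition procedure1 (R : realType) (K : 'M[R]_(3, 6)) (umax : R)
    (P : 'M[R]_6) (l : nat) (s : 'I_l -> 'cV[R]_3) (S : 'I_l -> 'M[R]_3)
    (kmax : nat) (Xn : 'I_kmax.+1 -> 'cV[R]_6) (rho : 'I_kmax.+1 -> R) : Prop :=
  exists rho_s : 'I_kmax.+1 -> R,
    (forall j, is_safe_scale K umax P s S (Xn j) (rho_s j)) /\
    (forall k, rho k = \big[Num.min/rho_s ord0]_(j < kmax.+1) rho_s j).

Definition ellipsoid (R : realType) (P : 'M[R]_6) (kmax : nat)
    (Xn : 'I_kmax.+1 -> 'cV[R]_6) (rho : 'I_kmax.+1 -> R) (k : 'I_kmax.+1)
    : set 'cV[R]_6 :=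
  [set X | quad P (X - Xn k) <= rho k].

Definition tube (R : realType) (P : 'M[R]_6) (kmax : nat)
    (Xn : 'I_kmax.+1 -> 'cV[R]_6) (rho : 'I_kmax.+1 -> R) : set 'cV[R]_6 :=
  \bigcup_(k in [set: 'I_kmax.+1]) ellipsoid P Xn rho k.

Definition safe_tube (R : realType) (K : 'M[R]_(3, 6)) (umax : R)
    (l : nat) (s : 'I_l -> 'cV[R]_3) (S : 'I_l -> 'M[R]_3)
    (kmax : nat) (Xn : 'I_kmax.+1 -> 'cV[R]_6) (T : set 'cV[R]_6) : Prop :=
  forall (k : nat) (X : 'cV[R]_6), T X ->
    (forall i : 'I_l, excl_constraint (s i) (S i) X) /\
    exists delta : int, ctrl_constraint K umax X (Xn (cyc kmax (k%:Z + delta))).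

Definition closed_loop (R : realType) (A : 'M[R]_6) (B : 'M[R]_(6, 3))
    (K : 'M[R]_(3, 6)) (kmax : nat) (Xn : 'I_kmax.+1 -> 'cV[R]_6) (delta : int)
    (k1 : nat) (X : nat -> 'cV[R]_6) : Prop :=
  forall k : nat, (k1 <= k)%N ->
    X k.+1 = (A + B *m K) *m X k - B *m K *m Xn (cyc kmax (k%:Z + delta)).

(* The property depends on the indexed family of ellipsoids [E] whose union is
   the tube, not only on the union. *)
Definition positively_invariant (R : realType) (A : 'M[R]_6) (B : 'M[R]_(6, 3))
    (K : 'M[R]_(3, 6)) (kmax : nat) (Xn : 'I_kmax.+1 -> 'cV[R]_6)
    (E : 'I_kmax.+1 -> set 'cV[R]_6) : Prop :=
  exists delta : int, forall (k1 : nat) (X : nat -> 'cV[R]_6),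
    closed_loop A B K Xn delta k1 X ->
    E (cyc kmax (k1%:Z + delta)) (X k1) ->
    forall k2 : nat, (k1 <= k2)%N -> E (cyc kmax (k2%:Z + delta)) (X k2).

(* Main.v *)
Require Import Defs.
From HB Require Import structures.
From mathcomp Require Import all_boot all_order all_algebra.
From mathcomp Require Import all_classical all_reals all_analysis.
From mathcomp Require Import complex.
From mathcomp Require Import ring lra.

Set Implicit Arguments.
Unset Strict Implicit.
Unset Printing Implicit Defensive.

Import Order.TTheory GRing.Theory Num.Theory.
Import numFieldNormedType.Exports.

Local Open Scope classical_set_scope.
Local Open Scope ring_scope.

(** Each error [e = X - Xn] obeys [e(k+1) = (A + B K) e(k)], and the Lyapunov
    equation makes [quad P e] decrease along it by [quad Q e >= 0]. Sublevel sets
    of [quad P] centred at the moving reference are therefore invariant, provided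
    that one level is used for all the centres and that the reference still
    follows [A] when its index wraps around.

    The wrap-around is the periodicity of the natural motion. On the states with
    [y' = - 2 omega x] the Clohessy-Wiltshire matrix [M] satisfies
    [M^3 = - omega^2 M], so [exp (t M)] acts there by Rodrigues' formula
    [1 + (sin (omega t) / omega) M + ((1 - cos (omega t)) / omega^2) M^2]
    ([expmx_rodrigues], [cw_A_orbit]), which is the identity at
    [t = 2 pi / omega] ([cw_A_period]).

    Safety needs the two kinds of extremal levels to exist and to be positive.
    Both rest on the coercivity [c |v|^2 <= quad P v] of a positive definite form
    ([quad_coercive]). For the control bound the largest level is a supremum
    ([rho_u_exists]); it is finite only if [K != 0]. This holds because [A]
    fixes the along-track direction [y], so that [K = 0] would contradict the
    strict decrease of [quad P] in that direction. For an exclusion zone the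
    smallest level is attained by compactness, and it is positive because the
    reference avoids the zone ([rho_O_exists]). The ellipsoid whose level is this
    minimum may touch the zone but not enter its interior: from an interior
    point one could move towards the centre, staying in the zone and lowering the
    level ([rho_O_excl]). *)

(** * Matrix norms and continuity *)

(** Joining the completeness of matrices with their norm makes absolutely
    convergent matrix series converge. *)
HB.instance Definition _ (R : realType) m n := Complete.on 'M[R]_(m, n).

Lemma entry_le_norm (R : realType) m n (M : 'M[R]_(m, n)) i j :
  `|M i j| <= `|M|.
Proof.
rewrite [leRHS]/Num.norm /= mx_normrE; apply/bigmax_geP; right => /=.
by exists (i, j).
Qed.

Lemma norm_le_entries (R : realType) m n (M : 'M[R]_(m, n)) c :
  0 <= c -> (forall i j, `|M i j| <= c) -> `|M| <= c.
Proof.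
move=> c0 Mc; rewrite [leLHS]/Num.norm /= mx_normrE; apply/bigmax_leP.
by split=> // -[i j] _ /=.
Qed.

(** The maximum norm is submultiplicative only up to the inner dimension. *)
Lemma norm_mulmx_le (R : realType) m n p (A : 'M[R]_(m, n)) (B : 'M[R]_(n, p)) :
  `|A *m B| <= n%:R * `|A| * `|B|.
Proof.
apply: norm_le_entries => [|i j]; first by rewrite !mulr_ge0.
rewrite mxE (le_trans (ler_norm_sum _ _ _))//.
rewrite -mulrA mulr_natl -[X in _ *+ X]card_ord -sumr_const ler_sum// => k _.
by rewrite normrM ler_pM ?entry_le_norm.
Qed.

Lemma continuous_sum (R : realType) (T : topologicalType) (I : finType)
    (f : I -> T -> R) :
  (forall i, continuous (f i)) -> continuous (fun x => \sum_i f i x).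
Proof.
move=> cf x; apply: cvg_big => [|i _]; first exact: add_continuous.
exact: cf.
Qed.

Lemma trmx_continuous (R : realType) m n : continuous (@trmx R m n).
Proof.
move=> M A [P MP PA]; exists (fun i j => P j i).
  by move=> i j; have := MP j i; rewrite mxE.
by move=> N NP; apply: PA => i j; rewrite mxE; exact: NP.
Qed.

(** Transposition carries the Heine-Borel property of row vectors to column
    vectors. *)
Lemma cV_bounded_closed_compact (R : realType) n (A : set 'cV[R]_n) c :
  (forall x, A x -> `|x| <= c) -> closed A -> compact A.
Proof.
move=> Ac clA.
have -> : A = trmx @` (trmx @^-1` A : set 'rV[R]_n).
  apply/seteqP; split => [x Ax|_ [x Ax <-]//].
  by exists x^T; rewrite /= ?trmxK.
apply: continuous_compact.
  by apply: continuous_subspaceT; exact: trmx_continuous.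
apply: bounded_closed_compact; last first.
  by apply: preimage_closed => // x _; exact: trmx_continuous.
exists c; split => [|d cd x Ax]; first exact: num_real.
apply: (le_trans _ (ltW cd)); apply: norm_le_entries => [|i j].
  by apply: le_trans (Ac _ Ax).
apply: le_trans (Ac _ Ax); have -> : x i j = x^T j i by rewrite mxE.
exact: entry_le_norm.
Qed.

(** * The matrix exponential *)

(** The powers of [M] are dominated by those of the number [n |M|], so the series
    is dominated by the scalar exponential series. *)
Lemma is_cvg_expmx (R : realType) n (M : 'M[R]_n) :
  cvgn (series (fun j : nat => j`!%:R^-1 *: (M ^+ j : 'M[R]_n))).
Proof.
apply: normed_cvg => /=.
have expM j : `|M ^+ j : 'M[R]_n| <= `|1%:M : 'M[R]_n| * (n%:R * `|M|) ^+ j.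
  elim: j => [|j IH]; first by rewrite !expr0 mulr1.
  rewrite exprS; rewrite (le_trans (norm_mulmx_le _ _))// exprS mulrCA.
  by rewrite ler_wpM2l ?mulr_ge0.
apply: (@series_le_cvg _ _ (`|1%:M : 'M[R]_n| *: exp_coeff (n%:R * `|M|))).
- by move=> j; rewrite normr_ge0.
- by move=> j; rewrite /= /exp_coeff /= !mulr_ge0 ?exprn_ge0 ?mulr_ge0 ?invr_ge0.
- move=> j; rewrite /= normrZ ger0_norm ?invr_ge0//.
  by rewrite mulrC [leRHS]mulrA ler_wpM2r ?invr_ge0.
- exact/is_cvg_seriesZ/is_cvg_series_exp_coeff.
Qed.

(** Reduces the evaluation of [expmx M] on a vector to scalar series. *)
Lemma cvg_expmx_mul (R : realType) n (M : 'M[R]_n) (v : 'cV[R]_n) i :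
  (fun N => \sum_(0 <= j < N) j`!%:R^-1 * ((M ^+ j : 'M[R]_n) *m v) i 0) @ \oo
    --> (expmx M *m v) i 0.
Proof.
pose f (N : 'M[R]_n) : R := (N *m v) i 0.
have fE : f = fun N => \sum_j N i j * v j 0 by apply/funext => N; rewrite /f mxE.
have cf : continuous f.
  rewrite fE; apply: continuous_sum => j N.
  apply: (@continuousM _ _ (fun N : 'M[R]_n => N i j)).
    exact: coord_continuous.
  exact: cst_continuous.
have := @is_cvg_expmx R n M => /cvg_ex[L cL].
have eL : expmx M = L by exact/cvg_lim.
have : f \o series (fun j : nat => j`!%:R^-1 *: (M ^+ j : 'M[R]_n)) @ \oo --> f L.
  by apply: continuous_cvg => //; exact: cf.
rewrite -eL; apply: cvg_trans; apply: near_eq_cvg; near=> N.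
rewrite /= /f /series /= mulmx_suml summxE; apply: eq_bigr => j _.
by rewrite -scalemxAl mxE.
Unshelve. all: by end_near. Qed.

(** Rodrigues' formula. The relation turns the odd powers of [M], applied to [v],
    into multiples of [M v] and the positive even powers into multiples of
    [M^2 v]; the coefficients are the terms of the sine series and of the series
    of [1 - cos]. Asking for the relation on one vector only matters: the
    Clohessy-Wiltshire matrix satisfies it on a hyperplane, its other solutions
    drift. *)
Lemma expmx_rodrigues (R : realType) n (M : 'M[R]_n) (v : 'cV[R]_n) (th : R) :
  th != 0 -> M *m (M *m (M *m v)) = - th ^+ 2 *: (M *m v) ->
  expmx M *m v = v + (sin th / th) *: (M *m v)
                   + ((1 - cos th) / th ^+ 2) *: (M *m (M *m v)).
Proof.
move=> th0 M3.
have powS j : (M ^+ j.+1 : 'M[R]_n) *m v = M *m ((M ^+ j : 'M[R]_n) *m v).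
  by rewrite exprS mulmxA.
have podd k : (M ^+ k.*2.+1 : 'M[R]_n) *m v = (- th ^+ 2) ^+ k *: (M *m v).
  elim: k => [|k IH]; first by rewrite double0 expr1 expr0 scale1r.
  rewrite doubleS powS powS IH -!scalemxAr M3 scalerA.
  by rewrite [in RHS]exprSr.
have peven k : (M ^+ k.*2.+2 : 'M[R]_n) *m v
    = (- th ^+ 2) ^+ k *: (M *m (M *m v)).
  by rewrite powS podd -scalemxAr.
apply/colP => i.
apply: (norm_cvg_unique (@cvg_expmx_mul R n M v i)) => //.
have entryE (u w : 'cV[R]_n) s c : (v + s *: u + c *: w) i 0
    = v i 0 + s * u i 0 + c * w i 0 by rewrite !mxE.
rewrite entryE {entryE}.
set a := (M *m v) i 0; set b := (M *m (M *m v)) i 0.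
have term j : j`!%:R^-1 * ((M ^+ j : 'M[R]_n) *m v) i 0
    = (j == 0)%:R * v i 0 + a / th * sin_coeff th j
      + b / th ^+ 2 * ((j == 0)%:R - cos_coeff th j).
  case: j => [|j].
    rewrite expr0 mul1mx /sin_coeff /cos_coeff /= fact0 expr0 !mul0r.
    by rewrite invr1 !mul1r mulr0 addr0 subrr mulr0 addr0.
  have [k [->|->]] : exists k, j = k.*2.+1 \/ j = k.*2.
    exists j./2; have := odd_double_half j.
    by case: (odd j) => /= jE; [left|right]; rewrite -[LHS]jE.
  - rewrite peven /sin_coeff /cos_coeff /= odd_double /= uphalf_double.
    rewrite mxE -/b !mul0r mulr0 addr0 add0r sub0r mul1r.
    rewrite -exprnP doubleK [(- th ^+ 2) ^+ _]exprNn -exprM mul2n !exprS.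
    by field; rewrite th0 pnatr_eq0 -lt0n fact_gt0.
  - rewrite podd /sin_coeff /cos_coeff /= odd_double /= doubleK.
    rewrite mxE -/a !mul0r subr0 mulr0 addr0 add0r mul1r.
    rewrite [(- th ^+ 2) ^+ _]exprNn -exprM mul2n exprS.
    by field; rewrite th0 pnatr_eq0 -lt0n fact_gt0.
have cvs : series (sin_coeff th) @ \oo --> sin th.
  by rewrite sin.unlock; exact: is_cvg_series_sin_coeff.
have cvc : series (cos_coeff th) @ \oo --> cos th.
  by rewrite cos.unlock; exact: is_cvg_series_cos_coeff.
have -> : v i 0 + sin th / th * a + (1 - cos th) / th ^+ 2 * b
    = v i 0 + a / th * sin th + b / th ^+ 2 * (1 - cos th) by ring.
have : (fun N => v i 0 + a / th * series (sin_coeff th) N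
   + b / th ^+ 2 * (1 - series (cos_coeff th) N)) @ \oo -->
    v i 0 + a / th * sin th + b / th ^+ 2 * (1 - cos th).
  apply: cvgD; [apply: cvgD; [exact: cvg_cst | ] | ].
  - by apply: cvgM => //; exact: cvg_cst.
  - apply: cvgM; first exact: cvg_cst.
    by apply: cvgB => //; exact: cvg_cst.
apply: cvg_trans; apply: near_eq_cvg; near=> N.
have N0 : (0 < N)%N by near: N; exists 1%N.
under [RHS]eq_bigr do rewrite term.
rewrite !big_split /= -!mulr_suml -!mulr_sumr big_split /= sumrN.
suff -> : \sum_(0 <= j < N) ((j == 0)%:R : R) = 1 by rewrite mul1r.
by rewrite big_ltn// eqxx big_nat big1 ?addr0// => -[].
Unshelve. all: by end_near. Qed.

(** * Periodicity of the natural motion *)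

Lemma cw_Ac_mulE (R : realType) (w : R) (v : 'cV[R]_6) :
  cw_Ac w *m v = \col_i nth 0
    [:: v (inord 3) 0; v (inord 4) 0; v (inord 5) 0;
        3 * w ^+ 2 * v (inord 0) 0 + 2 * w * v (inord 4) 0;
        - (2 * w) * v (inord 3) 0; - w ^+ 2 * v (inord 2) 0] i.
Proof.
apply/colP => i; rewrite !mxE.
have ordE k (k6 : (k < 6)%N) : inord k = Ordinal k6 :> 'I_6.
  by apply/val_inj; rewrite /= inordK.
rewrite !big_ord_recl big_ord0 !mxE /=.
rewrite (ordE 0%N isT) (ordE 2%N isT) (ordE 3%N isT) (ordE 4%N isT) (ordE 5%N isT).
rewrite /bump /=.
case: i => [[|[|[|[|[|[|//]]]]]] i6] /=; rewrite ?mul0r ?add0r ?addr0 ?mul1r.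
all: try by congr (v _ 0); apply/val_inj.
by congr (_ * v _ 0 + _ * v _ 0); apply/val_inj.
all: by congr (_ * v _ 0); apply/val_inj.
Qed.

(** The initial condition removes the secular drift: with it, [x], [y'] and [z]
    are harmonic with frequency [omega]. *)
Lemma cw_Ac_cubed (R : realType) (w : R) (X0 : 'cV[R]_6) :
  nmt_init w X0 ->
  let M := cw_Ac w in M *m (M *m (M *m X0)) = - w ^+ 2 *: (M *m X0).
Proof.
move=> X0i M; rewrite {}/M !cw_Ac_mulE; apply/colP => i; rewrite !mxE !inordK//=.
rewrite X0i; case: i => [[|[|[|[|[|[|//]]]]]] i6] /=; ring.
Qed.

(** A pure along-track offset is an equilibrium of the relative motion. *)
Lemma cw_Ac_fixed (R : realType) (w : R) :
  cw_Ac w *m (delta_mx (inord 1) 0 : 'cV[R]_6) = 0.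
Proof.
rewrite cw_Ac_mulE; apply/colP => i; rewrite !mxE -!val_eqE /= !inordK//=.
case: i => [[|[|[|[|[|[|//]]]]]] i6] /=; ring.
Qed.

Lemma cw_A_rodrigues (R : realType) (w dT : R) (v : 'cV[R]_6) :
  w != 0 -> dT != 0 ->
  let M := cw_Ac w in
  M *m (M *m (M *m v)) = - w ^+ 2 *: (M *m v) ->
  cw_A w dT *m v = v + (sin (w * dT) / w) *: (M *m v)
                     + ((1 - cos (w * dT)) / w ^+ 2) *: (M *m (M *m v)).
Proof.
move=> w0 dT0 M M3.
rewrite /cw_A (@expmx_rodrigues _ _ _ _ (w * dT)) ?mulf_neq0//; last first.
  rewrite -!(scalemxAl, scalemxAr) -/M M3 !scalerA; congr (_ *: _); ring.
rewrite -!(scalemxAl, scalemxAr) -/M !scalerA.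
by congr (_ + _ *: _ + _ *: _); field; rewrite w0.
Qed.

Lemma cw_A_fixed (R : realType) (w dT : R) :
  w != 0 -> dT != 0 ->
  cw_A w dT *m (delta_mx (inord 1) 0 : 'cV[R]_6) = delta_mx (inord 1) 0.
Proof.
by move=> w0 dT0; rewrite cw_A_rodrigues// cw_Ac_fixed ?mulmx0 ?scaler0 ?addr0.
Qed.

(** One step acts on the span of [X0], [M X0] and [M^2 X0] by the formula above,
    and composing steps amounts to the addition formulas of sine and cosine. *)
Lemma cw_A_orbit (R : realType) (w dT : R) (X0 : 'cV[R]_6) (k : nat) :
  w != 0 -> dT != 0 -> nmt_init w X0 ->
  let M := cw_Ac w in let th := w * dT * k%:R in
  iter k (mulmx (cw_A w dT)) X0
    = X0 + (sin th / w) *: (M *m X0)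
         + ((1 - cos th) / w ^+ 2) *: (M *m (M *m X0)).
Proof.
move=> w0 dT0 X0i M; elim: k => [|k /= ->] /=.
  by rewrite mulr0 sin0 cos0 subrr !mul0r !scale0r !addr0.
have M3 := cw_Ac_cubed X0i; rewrite -/M /= in M3.
have step v : M *m (M *m (M *m v)) = - w ^+ 2 *: (M *m v) -> _ :=
  @cw_A_rodrigues _ w dT v w0 dT0.
rewrite 2!mulmxDr -!scalemxAr !step ?M3 -?scalemxAr ?M3 //.
rewrite -natr1 mulrDr mulr1 sinD cosD.
move: (M *m (M *m X0)) => c; move: (M *m X0) => b.
apply/colP => i; rewrite !mxE.
by field.
Qed.

Lemma cw_A_period (R : realType) (w dT : R) (X0 : 'cV[R]_6) (kmax : nat) :
  0 < w -> 0 < dT -> (2 * pi / w) / dT = kmax.+1%:R -> nmt_init w X0 ->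
  iter kmax.+1 (mulmx (cw_A w dT)) X0 = X0.
Proof.
move=> w0 dT0 kE X0i; rewrite cw_A_orbit ?gt_eqF//.
have -> : w * dT * kmax.+1%:R = 0 + pi *+ 2.
  by rewrite -kE add0r -mulr_natl; field; rewrite !gt_eqF.
by rewrite sinD2pi cosD2pi sin0 cos0 subrr !mul0r !scale0r !addr0.
Qed.

(** * Cyclic indices *)

Lemma cyc_nat (kmax k : nat) : cyc kmax k%:Z = inord (k %% kmax.+1).
Proof. by rewrite /cyc modz_nat. Qed.

Lemma cyc_ord (kmax : nat) (j : 'I_kmax.+1) : cyc kmax (j : nat)%:Z = j.
Proof. by rewrite cyc_nat modn_small// inord_val. Qed.

Lemma nmt_seq_cyc (R : realType) (A : 'M[R]_6) (X0 : 'cV[R]_6) (kmax k : nat) :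
  iter kmax.+1 (mulmx A) X0 = X0 ->
  nmt_seq A X0 (cyc kmax k%:Z) = iter k (mulmx A) X0.
Proof.
move=> per; rewrite /nmt_seq cyc_nat inordK ?ltn_pmod//.
rewrite [in RHS](divn_eq k kmax.+1) addnC iterD; congr (iter _ _ _).
by elim: (k %/ _)%N => [//|q IH]; rewrite mulSn iterD -IH.
Qed.

(** * Quadratic forms *)

Lemma quadE (R : realType) n (M : 'M[R]_n) (v : 'cV[R]_n) :
  quad M v = \sum_j (\sum_i v i 0 * M i j) * v j 0.
Proof.
rewrite /quad mxE; apply: eq_bigr => j _; congr (_ * _).
by rewrite mxE; apply: eq_bigr => i _; rewrite mxE.
Qed.

Lemma quadZ (R : realType) n (M : 'M[R]_n) (t : R) (v : 'cV[R]_n) :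
  quad M (t *: v) = t ^+ 2 * quad M v.
Proof.
rewrite /quad; have -> : (t *: v)^T = t *: v^T by apply/matrixP => i j; rewrite !mxE.
by rewrite -!scalemxAl -scalemxAr !mxE mulrA expr2.
Qed.

Lemma quad0 (R : realType) n (M : 'M[R]_n) : quad M 0 = 0.
Proof. by rewrite /quad mulmx0 mxE. Qed.

Lemma quad_ge0 (R : realType) n (M : 'M[R]_n) (v : 'cV[R]_n) :
  sym_posdef M -> 0 <= quad M v.
Proof.
by move=> [_ Mp]; have [->|/Mp/ltW//] := eqVneq v 0; rewrite quad0.
Qed.

(** Only the shape of the dependence on [u] is used, so the coefficient of the
    linear term stays abstract. *)
Lemma quad_line (R : realType) n (M : 'M[R]_n) (b d : 'cV[R]_n) :
  exists be, forall u, quad M (b + u *: d) = quad M b + u * be + u ^+ 2 * quad M d.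
Proof.
exists ((b^T *m M *m d + d^T *m M *m b) 0 0) => u; rewrite /quad.
have -> : (b + u *: d)^T = b^T + u *: d^T by apply/matrixP => i j; rewrite !mxE.
rewrite !mulmxDl !mulmxDr -!(scalemxAl, scalemxAr).
move: (b^T *m M *m b) (b^T *m M *m d) (d^T *m M *m b) (d^T *m M *m d).
by move=> bb bd db dd; rewrite !mxE; ring.
Qed.

Lemma continuous_quad_affine (R : realType) n p (M : 'M[R]_p)
    (L : 'M[R]_(p, n)) (s : 'cV[R]_p) :
  continuous (fun X : 'cV[R]_n => quad M (L *m X - s)).
Proof.
have ce (j : 'I_p) : continuous (fun X : 'cV[R]_n => (L *m X - s) j 0).
  have -> : (fun X : 'cV[R]_n => (L *m X - s) j 0)
      = fun X => \sum_k L j k * X k 0 - s j 0.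
    by apply/funext => X; rewrite !mxE.
  move=> X.
  apply: (@continuousB _ _ _ (fun X : 'cV[R]_n => \sum_k L j k * X k 0)
     (cst (s j 0))); last exact: cst_continuous.
  apply: continuous_sum => k {}X.
  apply: (@continuousM _ _ (cst (L j k)) (fun X : 'cV[R]_n => X k 0)).
    exact: cst_continuous.
  exact: coord_continuous.
have -> : (fun X : 'cV[R]_n => quad M (L *m X - s))
    = fun X => \sum_j (\sum_i (L *m X - s) i 0 * M i j) * (L *m X - s) j 0.
  by apply/funext => X; rewrite quadE.
apply: continuous_sum => j X.
apply: (@continuousM _ _ (fun X : 'cV[R]_n => \sum_i (L *m X - s) i 0 * M i j)
   (fun X : 'cV[R]_n => (L *m X - s) j 0)); last exact: ce.
apply: continuous_sum => i {}X.
apply: (@continuousM _ _ (fun X : 'cV[R]_n => (L *m X - s) i 0) (cst (M i j))).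
  exact: ce.
exact: cst_continuous.
Qed.

(** By homogeneity [c] can be taken to be the minimum of the form on the unit
    sphere, which is compact. *)
Lemma quad_coercive (R : realType) n (M : 'M[R]_n) :
  sym_posdef M ->
  exists2 c, 0 < c & forall v : 'cV[R]_n, c * `|v| ^+ 2 <= quad M v.
Proof.
move=> [_ Mp].
have cq : continuous (quad M).
  have -> : quad M = fun X => quad M (1%:M *m X - 0).
    by apply/funext => X; rewrite mul1mx subr0.
  exact: continuous_quad_affine.
pose S := [set v : 'cV[R]_n | `|v| = 1].
have [S0|S0] := pselect (S !=set0); last first.
  exists 1 => // v; have [->|v0] := eqVneq v 0.
    by rewrite normr0 expr0n mulr0 quad0.
  exfalso; apply: S0; exists (`|v|^-1 *: v); rewrite /S /= normrZ.
  by rewrite ger0_norm ?invr_ge0// mulVf// normr_eq0.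
have cS : compact S.
  apply: (@cV_bounded_closed_compact _ _ _ 1); first by move=> x /= ->.
  apply: (@preimage_closed _ _ (fun v : 'cV[R]_n => `|v|) [set 1]) => [x _|].
    exact: norm_continuous.
  exact: closed_eq.
have [w] := @compact_EVT_min _ R _ _ S0 cS (continuous_subspaceT cq).
rewrite inE => w1 wmin.
exists (quad M w).
  by apply: Mp; rewrite -normr_eq0 w1 oner_eq0.
move=> v; have [->|v0] := eqVneq v 0; first by rewrite normr0 expr0n mulr0 quad0.
have v1 : `|v|^-1 *: v \in S.
  by rewrite inE /S /= normrZ ger0_norm ?invr_ge0// mulVf// normr_eq0.
have := wmin _ v1; rewrite quadZ exprVn ler_pdivlMl//.
  by rewrite mulrC.
by rewrite exprn_gt0// normr_gt0.
Qed.

(** The exact balance serves twice: strictly, to rule out a direction fixed by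
    [M], and weakly, for invariance. *)
Lemma quad_lyapunov (R : realType) n (M P Q : 'M[R]_n) (e : 'cV[R]_n) :
  M^T *m P *m M - P = - Q -> quad P (M *m e) - quad P e = - quad Q e.
Proof.
move=> MP; rewrite /quad -[Q]opprK -MP trmx_mul mulmxN mulNmx mulmxBr mulmxBl.
rewrite !mulmxA; move: (_ *m M *m e) (e^T *m P *m e) => a b.
by rewrite !mxE opprK.
Qed.

Lemma quad_decrease (R : realType) n (M P Q : 'M[R]_n) (e : 'cV[R]_n) :
  sym_posdef Q -> M^T *m P *m M - P = - Q ->
  quad P (M *m e) <= quad P e.
Proof.
by move=> hQ MP; rewrite -subr_le0 (quad_lyapunov _ MP) oppr_le0 quad_ge0.
Qed.

(** * Safe levels *)

(** The admissible levels contain a positive one by coercivity, and [K != 0]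
    bounds them. Their supremum is admissible: a violation on the level set of the
    supremum persists after a slight shrinking towards the centre, hence at a
    smaller, admissible level. *)
Lemma rho_u_exists (R : realType) (K : 'M[R]_(3, 6)) (umax : R) (P : 'M[R]_6)
    (Xref : 'cV[R]_6) :
  K != 0 -> sym_posdef P -> 0 < umax ->
  exists2 r, is_rho_u K umax P Xref r & 0 < r.
Proof.
move=> K0 hP umax0; have [c c0 coer] := quad_coercive hP.
pose D := [set rho | 0 <= rho /\ forall X : 'cV[R]_6,
  quad P (X - Xref) <= rho -> ctrl_constraint K umax X Xref].
have DP rho : D rho <->
    (0 <= rho /\ forall v, quad P v <= rho -> `|K *m v| <= umax).
  split=> -[rho0 H]; split=> //; last by move=> X; exact: H.
  by move=> v vr; have := H (v + Xref); rewrite /ctrl_constraint addrK; apply.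
(* [6] is the inner dimension of the product [K *m v]. *)
pose k := 6 * `|K|; have k0 : 0 < k by rewrite mulr_gt0// normr_gt0.
(* At level [r0], coercivity gives [|v| <= umax / k], hence [|K v| <= umax]. *)
pose r0 := c * (umax / k) ^+ 2.
have r00 : 0 < r0 by rewrite mulr_gt0// exprn_gt0// divr_gt0.
have Dr0 : D r0.
  apply/DP; split=> [|v vr]; first exact: ltW.
  have vk : `|v| <= umax / k.
    have uk0 : 0 <= umax / k by rewrite ltW// divr_gt0.
    rewrite -ler_sqr ?nnegrE//.
    by rewrite -(ler_pM2l c0) (le_trans (coer v)).
  by rewrite (le_trans (norm_mulmx_le _ _))// mulrC -ler_pdivlMr.
have [w wK] : exists w : 'cV[R]_6, umax < `|K *m w|.
  have [i [j Kij]] : exists i j, K i j != 0.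
    apply: contrapT => H; move/eqP: K0; apply; apply/matrixP => i j.
    by rewrite mxE; apply/eqP/negPn/negP => Kij; apply: H; exists i, j.
  pose v : 'cV[R]_6 := delta_mx j 0.
  have Kv0 : 0 < `|K *m v|.
    rewrite normr_gt0; apply: contra_neq Kij => Kv.
    by have := congr1 (fun M : 'cV_3 => M i 0) Kv; rewrite -colE !mxE.
  exists (((umax + 1) / `|K *m v|) *: v).
  rewrite -scalemxAr normrZ ger0_norm ?divr_ge0 ?ltW ?addr_gt0//.
  by rewrite divfK ?gt_eqF// ltrDl.
have ubD : ubound D (quad P w).
  move=> rho /DP[_ Hrho]; rewrite leNgt; apply/negP => /ltW /Hrho.
  by rewrite leNgt wK.
have supD : has_sup D by split; [exists r0 | exists (quad P w)].
have r0s : r0 <= sup D by exact: ub_le_sup (proj2 supD) _ Dr0.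
exists (sup D); last exact: lt_le_trans r0s.
split; last by move=> rho Drho; exact: ub_le_sup (proj2 supD) _ Drho.
apply/DP; split=> [|v vs]; first exact: le_trans (ltW r00) r0s.
rewrite leNgt; apply/negP => vK.
have Kv0 : 0 < `|K *m v| by exact: lt_trans vK.
have v0 : v != 0.
  by apply: contraTneq Kv0 => ->; rewrite mulmx0 normr0 ltxx.
have utv : umax / `|K *m v| < 1 by rewrite ltr_pdivrMr// mul1r.
have [t t1 t2] : exists2 t, umax / `|K *m v| < t & t < 1.
  by exists ((umax / `|K *m v| + 1) / 2); rewrite !midf_lt.
have t0 : 0 < t by rewrite (lt_trans _ t1)// divr_gt0.
have qv : 0 < quad P v by exact: (proj2 hP).
have [rho /DP[_ Hrho] rhot] : exists2 rho, D rho & quad P (t *: v) < rho.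
  apply: sup_gt => //; first by exists r0.
  apply: lt_le_trans vs; rewrite quadZ gtr_pMl// expr_lt1// ltW//.
have := Hrho _ (ltW rhot); rewrite -scalemxAr normrZ gtr0_norm// leNgt.
by rewrite -ltr_pdivrMr// t1.
Qed.

Lemma Phi_surj (R : realType) (s : 'cV[R]_3) : exists X, Phi R *m X = s.
Proof.
exists (col_mx s 0 : 'cV[R]_(3 + 3)).
have := @mul_row_col R 3 3 3 1 1%:M 0 s 0.
by rewrite mul1mx mul0mx addr0.
Qed.

(** The zone is unbounded, being a cylinder over a set of positions, so the
    minimum is taken over the part of the zone below the level of one of its
    points, which is compact by coercivity. *)
Lemma rho_O_exists (R : realType) (s : 'cV[R]_3) (S : 'M[R]_3)
    (P : 'M[R]_6) (Xref : 'cV[R]_6) :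
  sym_posdef P -> ~ excl_zone s S Xref ->
  exists2 r, is_rho_O s S P Xref r & 0 < r.
Proof.
move=> hP XrefO; have [c c0 coer] := quad_coercive hP.
have [X1 X1s] := Phi_surj s.
have X1O : excl_zone s S X1 by rewrite /excl_zone/= X1s subrr quad0 ler01.
pose f X := quad P (X - Xref).
have cf : continuous f.
  have -> : f = fun X => quad P (1%:M *m X - Xref).
    by apply/funext => X; rewrite mul1mx.
  exact: continuous_quad_affine.
pose C := excl_zone s S `&` [set X | f X <= f X1].
have cC : compact C.
  apply: (@cV_bounded_closed_compact _ _ _ (1 + f X1 / c + `|Xref|)).
    move=> X [_ /= fX]; rewrite -lerBlDr (le_trans (lerB_dist _ _))//.
    have : `|X - Xref| ^+ 2 <= f X1 / c.
      by rewrite ler_pdivlMr// mulrC (le_trans (coer _)).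
    by move: `|_| => y; nra.
  apply: closedI.
    apply: (@preimage_closed _ _ (fun X => quad S (Phi R *m X - s)) [set y | y <= 1]).
      by move=> x _; exact: continuous_quad_affine.
    exact: closed_le.
  apply: (@preimage_closed _ _ f [set y | y <= f X1]).
    by move=> x _; exact: cf.
  exact: closed_le.
have C0 : C !=set0 by exists X1; split => //=.
have [Y] := @compact_EVT_min _ R _ _ C0 cC (continuous_subspaceT cf).
rewrite inE => -[YO Y1] Ymin.
exists (f Y).
  split; first by exists Y.
  move=> rho [X [Xrho XO]]; apply: le_trans Xrho; rewrite -/(f X).
  have [X1X|XX1] := leP (f X1) (f X); first exact: le_trans X1X.
  by apply: Ymin; rewrite inE; split => //=; exact: ltW.
apply: (proj2 hP); rewrite subr_eq0; apply: contra_notN XrefO => /eqP <- //.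
Qed.

(** If [X] were in the interior of the zone, then so would be a point
    [Xref + (1 - u) (X - Xref)] with [u > 0] small, whose level is
    below the minimum. *)
Lemma rho_O_excl (R : realType) (s : 'cV[R]_3) (S : 'M[R]_3)
    (P : 'M[R]_6) (Xref X : 'cV[R]_6) (r : R) :
  is_rho_O s S P Xref r -> 0 < r -> quad P (X - Xref) <= r ->
  excl_constraint s S X.
Proof.
move=> [_ rmin] r0 Xr; rewrite /excl_constraint subr_le0 leNgt; apply/negP => X1.
pose a := Phi R *m Xref - s; pose b := Phi R *m X - s.
have [be quadb] := quad_line S b (a - b).
pose e := 1 - quad S b; have e0 : 0 < e by rewrite subr_gt0.
pose h := `|be| + `|quad S (a - b)|; have h0 : 0 <= h by rewrite addr_ge0.
(* Moving by [u] towards the centre changes the form by at most [u h], and [e] is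
   the room left below [1]; this choice gives both [u h <= e] and [u <= 1]. *)
pose u := e / (e + h).
have eh0 : 0 < e + h by rewrite ltr_pwDl.
have u0 : 0 < u by rewrite divr_gt0.
have u1 : u <= 1 by rewrite ler_pdivrMr// mul1r lerDl.
have uh : u * h <= e.
  by rewrite /u mulrAC ler_pdivrMr// ler_pM2l// lerDr ltW.
pose Y := Xref + (1 - u) *: (X - Xref).
have YO : excl_zone s S Y.
  rewrite /excl_zone /=.
  have -> : Phi R *m Y - s = b + u *: (a - b).
    rewrite /Y mulmxDr -scalemxAr mulmxBr /a /b.
    move: (Phi R *m X) (Phi R *m Xref) => p q.
    by apply/colP => i; rewrite !mxE; ring.
  rewrite quadb.
  have H1 : be <= `|be| by exact: ler_norm.
  have H2 : quad S (a - b) <= `|quad S (a - b)| by exact: ler_norm.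
  have : u * be + u ^+ 2 * quad S (a - b) <= u * h.
    rewrite /h mulrDr expr2 lerD ?ler_pM2l//.
    rewrite -mulrA ler_pM2l//.
    rewrite (le_trans (ler_wpM2l (ltW u0) H2))//.
    by rewrite ler_piMl.
  rewrite /e in uh; lra.
have : r <= quad P (Y - Xref) by apply: rmin; exists Y.
rewrite /Y addrAC subrr add0r quadZ leNgt => /negP; apply.
apply: (@le_lt_trans _ _ ((1 - u) ^+ 2 * r)).
  by rewrite ler_wpM2l// sqr_ge0.
by rewrite gtr_pMl// expr_lt1// ?subr_ge0// ltrBlDr ltrDl.
Qed.

(** * Safe and invariant tubes *)

Theorem theorem3 (R : realType) (dT m omega : R)
    (hdT : 0 < dT) (hm : 0 < m) (homega : 0 < omega)
    (kmax : nat) (hkmax : (2 * pi / omega) / dT = kmax.+1%:R)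
    (X0 : 'cV[R]_6) (hX0 : nmt_init omega X0)
    (K : 'M[R]_(3, 6))
    (hK : schur (cw_A omega dT + cw_B omega m dT *m K))
    (P Q : 'M[R]_6) (hP : sym_posdef P) (hQ : sym_posdef Q)
    (hPQ : (cw_A omega dT + cw_B omega m dT *m K)^T *m P
             *m (cw_A omega dT + cw_B omega m dT *m K) - P = - Q)
    (umax : R) (humax : 0 < umax)
    (l : nat) (s : 'I_l -> 'cV[R]_3) (S : 'I_l -> 'M[R]_3)
    (hS : forall i : 'I_l, sym_posdef (S i))
    (hdisj : forall i : 'I_l,
       range (nmt_seq (cw_A omega dT) X0 (kmax := kmax))
         `&` excl_zone (s i) (S i) = set0) :
  let A := cw_A omega dT in
  let B := cw_B omega m dT in
  let Xn := nmt_seq A X0 (kmax := kmax) in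
  exists rho : 'I_kmax.+1 -> R,
    [/\ procedure1 K umax P s S Xn rho,
        forall k : 'I_kmax.+1, 0 < rho k,
        safe_tube K umax s S Xn (tube P Xn rho) &
        positively_invariant A B K Xn (ellipsoid P Xn rho)].
Proof.
move=> A B Xn; pose F := A + B *m K.
have w0 : omega != 0 by rewrite gt_eqF.
have dT0 : dT != 0 by rewrite gt_eqF.
have K0 : K != 0.
  (* With [K = 0] the along-track offset [e] is fixed, so [quad Q e = 0]. *)
  apply/eqP => K0; pose e : 'cV[R]_6 := delta_mx (inord 1) 0.
  have eN0 : e != 0.
    apply/eqP => /matrixP /(_ (inord 1) 0); rewrite !mxE !eqxx /=.
    by move/eqP; rewrite oner_eq0.
  have := quad_lyapunov e hPQ.
  rewrite K0 mulmx0 addr0 cw_A_fixed// => /eqP.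
  by rewrite subrr eq_sym oppr_eq0 gt_eqF//; exact: (proj2 hQ).
have XnO j i : ~ excl_zone (s i) (S i) (Xn j).
  move=> Xj; have : (range Xn `&` excl_zone (s i) (S i)) (Xn j) by split=> //; exists j.
  by rewrite /Xn hdisj.
have /choice[ru ruP] : forall j, exists r, is_rho_u K umax P (Xn j) r /\ 0 < r.
  by move=> j; have [r ? ?] := rho_u_exists (Xn j) K0 hP humax; exists r.
have /choice[ro roP] : forall ji : 'I_kmax.+1 * 'I_l, exists r,
    is_rho_O (s ji.2) (S ji.2) P (Xn ji.1) r /\ 0 < r.
  move=> [j i] /=; have [r ? ?] := rho_O_exists hP (@XnO j i); by exists r.
pose rs j := \big[Num.min/ru j]_(i < l) ro (j, i).
have rs_gt0 j : 0 < rs j.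
  by apply: lt_bigmin => [|i _]; [exact: (ruP j).2 | exact: (roP (j, i)).2].
pose r := \big[Num.min/rs ord0]_(j < kmax.+1) rs j.
have r_le_u j : r <= ru j.
  by apply: (@le_trans _ _ (rs j)); [exact: bigmin_le | exact: bigmin_le_id].
have r_le_o j i : r <= ro (j, i).
  by apply: (@le_trans _ _ (rs j)); exact: bigmin_le.
exists (fun=> r); split.
- exists rs; split=> // j.
  exists (ru j), (fun i => ro (j, i)); split => //; first exact: (ruP j).1.
  by move=> i; exact: (roP (j, i)).1.
- by move=> _; exact: lt_bigmin.
- move=> k X [j _ Xj]; split=> [i|].
    have [ro1 ro2] := roP (j, i).
    exact: rho_O_excl ro1 ro2 (le_trans Xj (r_le_o j i)).
  (* This shift makes the centre of the ellipsoid containing [X] the reference. *)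
  exists ((j : nat)%:Z - k%:Z); rewrite addrCA subrr addr0 cyc_ord.
  by have [[[_ H] _] _] := ruP j; apply: H; exact: le_trans Xj (r_le_u j).
- exists 0 => k1 X XS; rewrite addr0 => Xk1 k2 k12; rewrite addr0.
  have per := cw_A_period homega hdT hkmax hX0.
  rewrite -(subnK k12); elim: (k2 - k1)%N => [|d IH]; first by rewrite add0n.
  apply: le_trans IH; rewrite addSn XS ?leq_addl// addr0.
  have -> : Xn (cyc kmax (d + k1).+1%:Z) = A *m Xn (cyc kmax (d + k1)%:Z).
    by rewrite /Xn !nmt_seq_cyc.
  set x := X _; set y := Xn _.
  have -> : F *m x - B *m K *m y - A *m y = F *m (x - y).
    by rewrite mulmxBr [F *m y]mulmxDl opprD addrA addrAC.
  exact: quad_decrease hQ hPQ.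
Qed.
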